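(* Let $k\in\{1,\dots,14\}$ and $l\in\{1,2\}$, and assume that $$\sqrt{\frac{\gamma\nu_{l,2}+\bar a_l}{\gamma\mu_{k,1}+a_k}}\notin\mathbb{N}.$$ Then there exist $E_k^l>0$ and a strictly increasing function $\Lambda:[0,\infty)\to[0,\infty)$ with $\Lambda(0)=0$ such that the $k$-th longitudinal mode $\overline\varphi_k$ at energy $E=E(\phi_0^k,\phi_1^k)>0$ is stable with respect to the $l$-th torsional mode provided that $$E\le E_k^l$$ or, equivalently, provided that $$\|\overline\varphi_k\|_\infty^2\le\Lambda(E_k^l).$$
   Context: Constants. $\sigma=0.2$, $\ell=\frac{\pi}{150}$, and $\gamma>0$ is a fixed real constant. For an integer $k\ge1$: - $\mu_{k,1}$ is the unique $\lambda\in((1-\sigma)^2k^4,k^4)$ such that $$\sqrt{k^2-\lambda^{1/2}}\big(\lambda^{1/2}+(1-\sigma)k^2\big)^2\tanh\big(\ell\sqrt{k^2-\lambda^{1/2}}\big)=\sqrt{k^2+\lambda^{1/2}}\big(\lambda^{1/2}-(1-\sigma)k^2\big)^2\tanh\big(\ell\sqrt{k^2+\lambda^{1/2}}\big).$$ - $\nu_{k,2}$ is the smallest $\lambda>k^4$ such that $$\sqrt{\lambda^{1/2}-k^2}\big(\lambda^{1/2}+(1-\sigma)k^2\big)^2\tanh\big(\ell\sqrt{\lambda^{1/2}+k^2}\big)=\sqrt{\lambda^{1/2}+k^2}\big(\lambda^{1/2}-(1-\sigma)k^2\big)^2\tan\big(\ell\sqrt{\lambda^{1/2}-k^2}\big).$$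 Put $\beta_k^{\pm}=k^2\pm\mu_{k,1}^{1/2}$ ($k=1,\dots,14$), $\alpha_k^{\pm}=\nu_{k,2}^{1/2}\pm k^2$ ($k=1,2$) and $$v_k(y)=\Big[\tfrac{k^2}{5}-\beta_k^-\Big]\frac{\cosh(y\sqrt{\beta_k^+})}{\cosh(\frac{\pi}{150}\sqrt{\beta_k^+})}+\Big[\beta_k^+-\tfrac{k^2}{5}\Big]\frac{\cosh(y\sqrt{\beta_k^-})}{\cosh(\frac{\pi}{150}\sqrt{\beta_k^-})}\quad(k=1,\dots,14),$$ $$\theta_k(y)=\Big[\tfrac{k^2}{5}+\alpha_k^-\Big]\frac{\sinh(y\sqrt{\alpha_k^+})}{\sinh(\frac{\pi}{150}\sqrt{\alpha_k^+})}+\Big[\alpha_k^+-\tfrac{k^2}{5}\Big]\frac{\sin(y\sqrt{\alpha_k^-})}{\sin(\frac{\pi}{150}\sqrt{\alpha_k^-})}\quad(k=1,2),$$ $$\omega_k^2=\pi\int_0^{\pi/150}v_k^2\,dy\quad(k=1,\dots,14),\qquad\bar\omega_k^2=\pi\int_0^{\pi/150}\theta_k^2\,dy\quad(k=1,2),$$ $$a_k=\frac{\pi}{\omega_k^2}\int_{3\pi/500}^{\pi/150}v_k^2\,dy,\qquad b_k=\frac{3\pi}{4\omega_k^4}\int_{3\pi/500}^{\pi/150}v_k^4\,dy,\qquad\bar a_l=\frac{\pi}{\bar\omega_l^2}\int_{3\pi/500}^{\pi/150}\theta_l^2\,dy,$$ $$d_{l,k}=\frac{9\pi}{4\omega_l^2\bar\omega_l^2}\int_{3\pi/500}^{\pi/150}v_l^2\theta_l^2\,dy\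 \text{ if }l=k,\qquad d_{l,k}=\frac{3\pi}{2\omega_k^2\bar\omega_l^2}\int_{3\pi/500}^{\pi/150}v_k^2\theta_l^2\,dy\ \text{ if }l\ne k.$$ Longitudinal mode. For $(\phi_0^k,\phi_1^k)\in\mathbb{R}^2\setminus\{(0,0)\}$, the $k$-th longitudinal mode $\overline\varphi_k$ at energy $$E(\phi_0^k,\phi_1^k)=\frac{(\phi_1^k)^2}{2}+(\gamma\mu_{k,1}+a_k)\frac{(\phi_0^k)^2}{2}+b_k\frac{(\phi_0^k)^4}{4}$$ is the unique (periodic) solution of $$\varphi''(t)+(\gamma\mu_{k,1}+a_k)\varphi(t)+b_k\varphi(t)^3=0,\qquad\varphi(0)=\phi_0^k,\ \varphi'(0)=\phi_1^k.$$ (Initial data with the same energy give the same solution up to a time translation.) $\|\cdot\|_\infty$ is the sup-norm. Torsional stability. The mode $\overline\varphi_k$ at energy $E(\phi_0^k,\phi_1^k)$ is called stable with respect to the $l$-th torsional mode if the trivial solution $\xi\equiv0$ of the Hill equation $$\xi''(t)+A_{l,k}(t)\xi(t)=0,\qquad A_{l,k}(t)=\gamma\nu_{l,2}+\bar a_l+d_{l,k}\overline\varphi_k(t)^2,$$ is stable in the Lyapunov sense, i.e. solutions with small $|\xi(0)|$, $|\xi'(0)|$ remain small for all $t\ge0$. *)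

(* Defs.v *)
From Stdlib Require Import Reals.
From Coquelicot Require Import Coquelicot.
Open Scope R_scope.

Definition sigma : R := 1 / 5.
Definition ell : R := PI / 150.

Definition is_mu1 (k : nat) (lam : R) : Prop :=
  (1 - sigma) ^ 2 * INR k ^ 4 < lam < INR k ^ 4 /\
  sqrt (INR k ^ 2 - sqrt lam) * (sqrt lam + (1 - sigma) * INR k ^ 2) ^ 2
    * tanh (ell * sqrt (INR k ^ 2 - sqrt lam))
  = sqrt (INR k ^ 2 + sqrt lam) * (sqrt lam - (1 - sigma) * INR k ^ 2) ^ 2
    * tanh (ell * sqrt (INR k ^ 2 + sqrt lam)).

(* At a pole of the tangent, [tan] takes the value [sin x / 0 = 0]; as the
   left-hand side is positive when [k ^ 4 < lam], this creates no spurious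
   solution. *)
Definition nu_equation (k : nat) (lam : R) : Prop :=
  sqrt (sqrt lam - INR k ^ 2) * (sqrt lam + (1 - sigma) * INR k ^ 2) ^ 2
    * tanh (ell * sqrt (sqrt lam + INR k ^ 2))
  = sqrt (sqrt lam + INR k ^ 2) * (sqrt lam - (1 - sigma) * INR k ^ 2) ^ 2
    * tan (ell * sqrt (sqrt lam - INR k ^ 2)).

Definition is_nu2 (k : nat) (lam : R) : Prop :=
  INR k ^ 4 < lam /\ nu_equation k lam /\
  forall lam' : R, INR k ^ 4 < lam' -> nu_equation k lam' -> lam <= lam'.

(* From here on [mu k] stands for mu_{k,1} and [nu k] for nu_{k,2}; the
   definitions are meaningful when [is_mu1 k (mu k)] and [is_nu2 k (nu k)]. *)

Definition beta_plus (mu : nat -> R) (k : nat) : R := INR k ^ 2 + sqrt (mu k).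
Definition beta_minus (mu : nat -> R) (k : nat) : R := INR k ^ 2 - sqrt (mu k).
Definition alpha_plus (nu : nat -> R) (k : nat) : R := sqrt (nu k) + INR k ^ 2.
Definition alpha_minus (nu : nat -> R) (k : nat) : R := sqrt (nu k) - INR k ^ 2.

Definition v (mu : nat -> R) (k : nat) (y : R) : R :=
  (INR k ^ 2 / 5 - beta_minus mu k)
    * (cosh (y * sqrt (beta_plus mu k)) / cosh (PI / 150 * sqrt (beta_plus mu k)))
  + (beta_plus mu k - INR k ^ 2 / 5)
    * (cosh (y * sqrt (beta_minus mu k)) / cosh (PI / 150 * sqrt (beta_minus mu k))).

Definition theta (nu : nat -> R) (k : nat) (y : R) : R :=
  (INR k ^ 2 / 5 + alpha_minus nu k)
    * (sinh (y * sqrt (alpha_plus nu k)) / sinh (PI / 150 * sqrt (alpha_plus nu k)))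
  + (alpha_plus nu k - INR k ^ 2 / 5)
    * (sin (y * sqrt (alpha_minus nu k)) / sin (PI / 150 * sqrt (alpha_minus nu k))).

(* The squares omega_k^2 and bar-omega_k^2. *)
Definition omega_sq (mu : nat -> R) (k : nat) : R :=
  PI * RInt (fun y => v mu k y ^ 2) 0 (PI / 150).
Definition omegabar_sq (nu : nat -> R) (k : nat) : R :=
  PI * RInt (fun y => theta nu k y ^ 2) 0 (PI / 150).

Definition a (mu : nat -> R) (k : nat) : R :=
  PI / omega_sq mu k * RInt (fun y => v mu k y ^ 2) (3 * PI / 500) (PI / 150).

Definition b (mu : nat -> R) (k : nat) : R :=
  3 * PI / (4 * omega_sq mu k ^ 2)
    * RInt (fun y => v mu k y ^ 4) (3 * PI / 500) (PI / 150).

Definition abar (nu : nat -> R) (l : nat) : R :=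
  PI / omegabar_sq nu l
    * RInt (fun y => theta nu l y ^ 2) (3 * PI / 500) (PI / 150).

Definition d (mu nu : nat -> R) (l k : nat) : R :=
  if Nat.eqb l k then
    9 * PI / (4 * omega_sq mu l * omegabar_sq nu l)
      * RInt (fun y => v mu l y ^ 2 * theta nu l y ^ 2) (3 * PI / 500) (PI / 150)
  else
    3 * PI / (2 * omega_sq mu k * omegabar_sq nu l)
      * RInt (fun y => v mu k y ^ 2 * theta nu l y ^ 2) (3 * PI / 500) (PI / 150).

(* Differentiability of [f] is required separately, because [Derive f] is a
   total function. *)
Definition twice_derivable (f : R -> R) : Prop :=
  forall t : R, ex_derive f t /\ ex_derive (Derive f) t.

Definition energy (gamma : R) (mu : nat -> R) (k : nat) (phi0 phi1 : R) : R :=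
  phi1 ^ 2 / 2 + (gamma * mu k + a mu k) * (phi0 ^ 2 / 2)
  + b mu k * (phi0 ^ 4 / 4).

Definition is_longitudinal_mode (gamma : R) (mu : nat -> R) (k : nat)
    (phi0 phi1 : R) (phi : R -> R) : Prop :=
  twice_derivable phi /\
  (forall t : R,
     Derive (Derive phi) t + (gamma * mu k + a mu k) * phi t
       + b mu k * phi t ^ 3 = 0) /\
  phi 0 = phi0 /\ Derive phi 0 = phi1.

Definition hill_solution (A xi : R -> R) : Prop :=
  twice_derivable xi /\
  forall t : R, Derive (Derive xi) t + A t * xi t = 0.

(* Smallness is measured in the phase plane, i.e. for both xi and xi'. *)
Definition lyapunov_stable (A : R -> R) : Prop :=
  forall eps : R, 0 < eps ->
  exists delta : R, 0 < delta /\
    forall xi : R -> R, hill_solution A xi ->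
      Rabs (xi 0) < delta -> Rabs (Derive xi 0) < delta ->
      forall t : R, 0 <= t -> Rabs (xi t) < eps /\ Rabs (Derive xi t) < eps.

Definition hill_coefficient (gamma : R) (mu nu : nat -> R) (l k : nat)
    (phi : R -> R) (t : R) : R :=
  gamma * nu l + abar nu l + d mu nu l k * phi t ^ 2.

Definition torsionally_stable (gamma : R) (mu nu : nat -> R) (l k : nat)
    (phi : R -> R) : Prop :=
  lyapunov_stable (hill_coefficient gamma mu nu l k phi).

(* Extended-real valued, hence [p_infty] for an unbounded function. *)
Definition sup_norm (f : R -> R) : Rbar :=
  Lub_Rbar (fun y => exists t : R, y = Rabs (f t)).

(* Main.v *)
(* Two zeros of the Duffing solution [phi] at distance [T] make [phi ^ 2]
   [T]-periodic, by conservation of energy and uniqueness; Sturm comparison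
   provides zeros, and at small energy two of them lie at distance [T] close to
   [PI / w], where [w ^ 2 = gamma mu + a].  For a solution [xi] of the Hill
   equation the Wronskian [Z(t)] of [xi] and [xi (. + T)] is then constant.
   With [w' ^ 2 = gamma nu + abar], comparison with a rotation gives
   [w' Z(t) = - sin (w' T) F(t) + o(F(t))], where
   [F = w' ^ 2 xi ^ 2 + xi' ^ 2].  The non-resonance hypothesis says exactly
   that [sin (w' PI / w) <> 0], so [F] is comparable to a constant.  Floquet
   theory and existence theorems are thus avoided. *)

Require Import Defs.
From Stdlib Require Import Reals.
From Coquelicot Require Import Coquelicot.
From Stdlib Require Import ZArith Lra Psatz Classical.
Open Scope R_scope.

(** * Mean value estimates *)

Lemma MVT_is_derive (f df : R -> R) (x y : R) :
  x <= y ->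
  (forall t, x <= t <= y -> is_derive f t (df t)) ->
  exists c, x <= c <= y /\ f y - f x = df c * (y - x).
Proof.
intros Hxy Hf.
destruct (MVT_gen f x y df) as [c [Hc Heq]].
- intros t Ht. rewrite Rmin_left, Rmax_right in Ht by lra. apply Hf; lra.
- intros t Ht. rewrite Rmin_left, Rmax_right in Ht by lra.
  apply continuity_pt_filterlim, (ex_derive_continuous f).
  exists (df t); apply Hf; lra.
- rewrite Rmin_left, Rmax_right in Hc by lra. now exists c.
Qed.

Lemma Rabs_increment_le (f df : R -> R) (M x y : R) :
  x <= y ->
  (forall t, x <= t <= y -> is_derive f t (df t)) ->
  (forall t, x <= t <= y -> Rabs (df t) <= M) ->
  Rabs (f y - f x) <= M * (y - x).
Proof.
intros Hxy Hf Hdf.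
destruct (MVT_is_derive f df x y Hxy Hf) as [c [Hc ->]].
rewrite Rabs_mult, (Rabs_pos_eq (y - x)) by lra.
apply Rmult_le_compat_r; [lra | auto].
Qed.

Lemma is_derive_nonpos_le (f df : R -> R) (x y : R) :
  x <= y ->
  (forall t, x <= t <= y -> is_derive f t (df t)) ->
  (forall t, x <= t <= y -> df t <= 0) ->
  f y <= f x.
Proof.
intros Hxy Hf Hdf.
destruct (MVT_is_derive f df x y Hxy Hf) as [c [Hc Heq]].
specialize (Hdf c Hc). nra.
Qed.

Lemma is_derive_zero_const (f : R -> R) :
  (forall t, is_derive f t 0) -> forall x y, f x = f y.
Proof.
assert (H : forall g : R -> R, (forall t, is_derive g t 0) ->
              forall x y, x <= y -> g x = g y).
{ intros g Hg x y Hxy.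
  assert (K : Rabs (g y - g x) <= 0 * (y - x)).
  { apply (Rabs_increment_le g (fun _ => 0)); auto.
    intros; rewrite Rabs_R0; lra. }
  rewrite Rmult_0_l in K.
  pose proof (Rabs_pos (g y - g x)).
  destruct (Req_dec (g y - g x) 0) as [E|E]; [lra|].
  apply Rabs_pos_lt in E; lra. }
intros Hf x y. destruct (Rle_dec x y); [now apply H|].
symmetry; apply H; auto; lra.
Qed.

Lemma is_derive_shift (f : R -> R) (T t l : R) :
  is_derive f (t + T) l -> is_derive (fun s => f (s + T)) t l.
Proof.
intros H.
replace l with (scal 1 l) by (unfold scal; simpl; unfold mult; simpl; ring).
apply (is_derive_comp f (fun s => s + T)); [exact H|].
auto_derive; [trivial | ring].
Qed.

(** * Perturbed harmonic oscillators *)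

(* [auto_derive] leaves the derivative of a variable [f] eta-expanded. *)
Ltac rewrite_derive H :=
  match type of H with
  | is_derive ?f ?x ?l =>
      replace (Derive (fun y : R => f y) x) with l
        by (symmetry; exact (is_derive_unique f x l H))
  end.

(** A first-order system: with the derivative [u1] given explicitly, opposites and differences of
    translates are handled without [Derive]. *)
Definition hill_pair (w : R) (g u u1 : R -> R) : Prop :=
  forall t, is_derive u t (u1 t) /\ is_derive u1 t (- (w ^ 2 + g t) * u t).

Definition osc_energy (w : R) (u u1 : R -> R) (t : R) : R :=
  w ^ 2 * u t ^ 2 + u1 t ^ 2.

Lemma osc_energy_nonneg (w : R) (u u1 : R -> R) (t : R) :
  0 <= osc_energy w u u1 t.
Proof. unfold osc_energy; nra. Qed.

(** Gronwall: the derivative of the energy is [- 2 g u u1], and [2 w |u u1|] is at most the energy,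
    so the energy damped by [exp (- delta / w * x)] cannot increase. *)
Lemma osc_energy_growth (w delta : R) (g u u1 : R -> R) (t s : R) :
  0 < w -> hill_pair w g u u1 -> (forall x, Rabs (g x) <= delta) -> 0 <= s ->
  osc_energy w u u1 (t + s) <= osc_energy w u u1 t * exp (delta / w * s).
Proof.
intros Hw Hu Hg Hs.
set (K := delta / w).
assert (H : osc_energy w u u1 (t + s) * exp (- K * (t + s))
            <= osc_energy w u u1 t * exp (- K * t)).
{ apply (is_derive_nonpos_le (fun x => osc_energy w u u1 x * exp (- K * x))
    (fun x => (- (2 * g x * u x * u1 x) - K * osc_energy w u u1 x)
                * exp (- K * x))); [lra| |].
  - intros x _. destruct (Hu x) as [H1 H2]. unfold osc_energy.
    auto_derive.
    + repeat split; [eexists; apply H1 | eexists; apply H2].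
    + rewrite_derive H1. rewrite_derive H2. ring.
  - intros x _.
    assert (D : - (2 * g x * u x * u1 x) - K * osc_energy w u u1 x <= 0).
    { specialize (Hg x). apply Rabs_le_between in Hg.
      assert (Hd : delta = K * w) by (unfold K; field; lra).
      unfold osc_energy.
      assert (HK : 0 <= K) by nra.
      assert (A : - (2 * g x * u x * u1 x) <= K * (2 * w * Rabs (u x * u1 x))).
      { destruct (Rcase_abs (u x * u1 x)).
        - rewrite Rabs_left by auto. nra.
        - rewrite Rabs_right by auto. nra. }
      assert (B : 2 * w * Rabs (u x * u1 x) <= w ^ 2 * u x ^ 2 + u1 x ^ 2).
      { rewrite Rabs_mult, <- (pow2_abs (u x)), <- (pow2_abs (u1 x)).
        pose proof (pow2_ge_0 (w * Rabs (u x) - Rabs (u1 x))). nra. }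
      nra. }
    pose proof (exp_pos (- K * x)). nra. }
replace (- K * (t + s)) with (- K * t + - (K * s)) in H by ring.
rewrite exp_plus, exp_Ropp in H.
pose proof (exp_pos (- K * t)) as E1. pose proof (exp_pos (K * s)) as E2.
apply (Rmult_le_reg_r (exp (- K * t) * / exp (K * s))).
- apply Rmult_lt_0_compat; [auto | now apply Rinv_0_lt_compat].
- eapply Rle_trans; [apply H|]. right. field. lra.
Qed.

(** For [g = 0] the left-hand side vanishes. In general the error is the accumulated effect of [g]
    over a time [S], controlled by the energy growth over that time. *)
Lemma wronskian_shift_approx (w delta m S : R) (g u u1 : R -> R) (t : R) :
  0 < w -> hill_pair w g u u1 -> (forall x, Rabs (g x) <= delta) -> 0 <= S ->
  delta / w * S <= m -> m <= 1 ->
  Rabs (w * (u t * u1 (t + S) - u1 t * u (t + S))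
        + osc_energy w u u1 t * sin (w * S))
  <= 4 * m * osc_energy w u u1 t.
Proof.
intros Hw Hu Hg HS Hm Hm1.
set (F := osc_energy w u u1 t).
(* With [Z = u(t) u1 - u1(t) u] and [C = w^2 u(t) u + u1(t) u1], the pair
   [(w Z, C)] rotates with angular speed [w] when [g = 0], and [N] is then
   constant. *)
set (N := fun x => w * (u t * u1 x - u1 t * u x) * cos (w * (t + S - x))
     - (w ^ 2 * u t * u x + u1 t * u1 x) * sin (w * (t + S - x))).
set (dN := fun x => - (w * g x * u t * u x) * cos (w * (t + S - x))
     + g x * u1 t * u x * sin (w * (t + S - x))).
assert (Hdelta : 0 <= delta) by (eapply Rle_trans; [apply Rabs_pos | apply (Hg t)]).
assert (HF : 0 <= F) by apply osc_energy_nonneg.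
set (K := delta / w) in *.
assert (HK : 0 <= K) by (apply Rmult_le_pos; [auto | left; now apply Rinv_0_lt_compat]).
assert (HdK : delta = K * w) by (unfold K; field; lra).
assert (HN : Rabs (N (t + S) - N t) <= (K * (4 * F)) * (t + S - t)).
{ apply (Rabs_increment_le N dN); [lra| |].
  - intros x _. destruct (Hu x) as [H1 H2]. unfold N, dN.
    auto_derive.
    + repeat split; [eexists; apply H2 | eexists; apply H1
                    |eexists; apply H1 | eexists; apply H2].
    + rewrite_derive H1. rewrite_derive H2. unfold Rminus. ring.
  - intros x Hx.
    (* On [[t, t + S]] the growth exponent is at most [m <= 1], and [exp 1 <= 3]. *)
    assert (Hgr : osc_energy w u u1 x <= 3 * F).
    { replace x with (t + (x - t)) by ring.
      eapply Rle_trans.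
      { apply (osc_energy_growth w delta g); auto; lra. }
      fold F. fold K. rewrite Rmult_comm.
      apply Rmult_le_compat_r; [auto|].
      apply Rle_trans with (exp 1); [|apply exp_le_3].
      destruct (Req_dec (K * (x - t)) 1) as [->|]; [lra|].
      left; apply exp_increasing. nra. }
    unfold dN.
    set (th := w * (t + S - x)).
    assert (Hsc := sin2_cos2 th). unfold Rsqr in Hsc.
    pose proof (SIN_bound th). pose proof (COS_bound th).
    replace (- (w * g x * u t * u x) * cos th + g x * u1 t * u x * sin th)
      with (g x * (u x * (- (w * u t) * cos th + u1 t * sin th))) by ring.
    rewrite Rabs_mult.
    set (a1 := - (w * u t) * cos th + u1 t * sin th).
    assert (Ha1 : a1 ^ 2 <= F).
    { assert (0 <= (w * u t * sin th + u1 t * cos th) ^ 2) by apply pow2_ge_0.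
      assert (a1 ^ 2 + (w * u t * sin th + u1 t * cos th) ^ 2
              = F * (sin th * sin th + cos th * cos th))
        by (unfold a1, F, osc_energy; ring).
      rewrite Hsc in *. lra. }
    assert (Hux : w ^ 2 * u x ^ 2 <= 3 * F)
      by (unfold osc_energy in Hgr; pose proof (pow2_ge_0 (u1 x)); lra).
    assert (Hp : w * Rabs (u x * a1) <= 4 * F).
    { rewrite Rabs_mult. rewrite <- (pow2_abs (u x)) in Hux.
      rewrite <- (pow2_abs a1) in Ha1.
      pose proof (pow2_ge_0 (w * Rabs (u x) - Rabs a1)). nra. }
    apply Rle_trans with (delta * Rabs (u x * a1)).
    + apply Rmult_le_compat_r; [apply Rabs_pos | apply Hg].
    + rewrite HdK, Rmult_assoc. now apply Rmult_le_compat_l. }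
replace (N (t + S)) with (w * (u t * u1 (t + S) - u1 t * u (t + S))) in HN.
2:{ unfold N. replace (t + S - (t + S)) with 0 by ring.
    rewrite Rmult_0_r, cos_0, sin_0. ring. }
replace (N t) with (- (F * sin (w * S))) in HN.
2:{ unfold N, F, osc_energy. replace (t + S - t) with S by ring. ring. }
unfold Rminus in HN at 1. rewrite Ropp_involutive in HN.
eapply Rle_trans; [apply HN|].
replace (K * (4 * F) * (t + S - t)) with (4 * (K * S) * F) by ring.
apply Rmult_le_compat_r; lra.
Qed.

(** * Zeros of solutions, and stability for a periodic perturbation *)

Lemma hill_pair_opp (w : R) (g u u1 : R -> R) :
  hill_pair w g u u1 -> hill_pair w g (fun t => - u t) (fun t => - u1 t).
Proof.
intros Hu t. destruct (Hu t) as [H1 H2]. split.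
- now apply (is_derive_opp u).
- replace (- (w ^ 2 + g t) * - u t) with (- (- (w ^ 2 + g t) * u t)) by ring.
  now apply (is_derive_opp u1).
Qed.

Lemma hill_pair_continuity (w : R) (g u u1 : R -> R) :
  hill_pair w g u u1 -> continuity u.
Proof.
intros Hu t. apply continuity_pt_filterlim, (ex_derive_continuous u).
exists (u1 t). apply Hu.
Qed.

(** Sturm comparison with [sin (w (x - t0))]: for a positive [u] the Wronskian of the two would be
    nonincreasing over the half period, yet it goes from [- w u(t0) < 0] to
    [w u(t0 + PI / w) > 0]. *)
Lemma hill_pair_not_pos (w : R) (g u u1 : R -> R) (t0 : R) :
  0 < w -> hill_pair w g u u1 -> (forall x, 0 <= g x) ->
  ~ (forall x, t0 <= x <= t0 + PI / w -> 0 < u x).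
Proof.
intros Hw Hu Hg Hpos.
pose proof PI_RGT_0 as Hpi.
assert (Hlen : 0 < PI / w) by now apply Rdiv_lt_0_compat.
assert (H : u1 (t0 + PI / w) * sin (w * (t0 + PI / w - t0))
            - w * u (t0 + PI / w) * cos (w * (t0 + PI / w - t0))
         <= u1 t0 * sin (w * (t0 - t0)) - w * u t0 * cos (w * (t0 - t0))).
{ apply (is_derive_nonpos_le
    (fun x => u1 x * sin (w * (x - t0)) - w * u x * cos (w * (x - t0)))
    (fun x => - (g x * (u x * sin (w * (x - t0)))))); [lra| |].
  - intros x _. destruct (Hu x) as [H1 H2].
    auto_derive.
    + repeat split; [eexists; apply H2 | eexists; apply H1].
    + rewrite_derive H1. rewrite_derive H2. unfold Rminus. ring.
  - intros x Hx.
    assert (0 <= sin (w * (x - t0))).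
    { apply sin_ge_0; [nra|].
      apply Rle_trans with (w * (PI / w)); [nra|].
      right; field; lra. }
    specialize (Hpos x Hx). specialize (Hg x).
    assert (0 <= u x * sin (w * (x - t0))) by nra.
    nra. }
replace (w * (t0 + PI / w - t0)) with PI in H by (field; lra).
replace (w * (t0 - t0)) with 0 in H by ring.
rewrite sin_PI, cos_PI, sin_0, cos_0 in H.
assert (0 < u t0) by (apply Hpos; lra).
assert (0 < u (t0 + PI / w)) by (apply Hpos; lra).
nra.
Qed.

Lemma IVT_sign (f : R -> R) (x y : R) :
  continuity f -> f x <= 0 <= f y ->
  exists z, Rmin x y <= z <= Rmax x y /\ f z = 0.
Proof.
intros Hf Hxy.
destruct (IVT_gen f x y 0 Hf) as [z Hz]; [|now exists z].
rewrite Rmin_left, Rmax_right; lra.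
Qed.

Lemma hill_pair_zero (w : R) (g u u1 : R -> R) (t0 : R) :
  0 < w -> hill_pair w g u u1 -> (forall x, 0 <= g x) ->
  exists x, t0 <= x <= t0 + PI / w /\ u x = 0.
Proof.
intros Hw Hu Hg.
assert (H : forall v v1, hill_pair w g v v1 ->
              exists x, t0 <= x <= t0 + PI / w /\ v x <= 0).
{ intros v v1 Hv. apply NNPP; intros Hn.
  apply (hill_pair_not_pos w g v v1 t0 Hw Hv Hg).
  intros x Hx. apply Rnot_le_lt. intros Hle. apply Hn; now exists x. }
destruct (H _ _ Hu) as [x [Hx Hux]].
destruct (H _ _ (hill_pair_opp _ _ _ _ Hu)) as [y [Hy Huy]]. simpl in Huy.
destruct (IVT_sign u x y) as [z [Hz Huz]];
  [now apply (hill_pair_continuity w g u u1) | lra |].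
exists z; split; [|auto].
revert Hz. unfold Rmin, Rmax. destruct (Rle_dec x y); lra.
Qed.

(** At a zero [t1], the Wronskian estimate puts [w * u (t1 + S)] close to [u1 t1 * sin (w * S)]. At
    [S = PI / w - eta] and [S = PI / w + eta] the sine is [sin (w * eta)] and its opposite, beyond
    the relative error [4 * m], so [u] changes sign in between. *)
Lemma hill_pair_next_zero (w delta m eta : R) (g u u1 : R -> R) (t1 : R) :
  0 < w -> hill_pair w g u u1 -> (forall x, Rabs (g x) <= delta) ->
  0 < eta -> eta <= PI / (2 * w) ->
  delta / w * (2 * (PI / w)) <= m -> m <= 1 -> 4 * m < sin (w * eta) ->
  u t1 = 0 -> u1 t1 <> 0 ->
  exists T, PI / w - eta <= T <= PI / w + eta /\ u (t1 + T) = 0.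
Proof.
intros Hw Hu Hg He Hew Hm Hm1 Hs Hz Hnz.
pose proof PI_RGT_0 as Hpi.
assert (Hlen : 0 < PI / w) by now apply Rdiv_lt_0_compat.
replace (PI / (2 * w)) with (PI / w / 2) in Hew by (field; lra).
assert (Hdelta : 0 <= delta) by (eapply Rle_trans; [apply Rabs_pos | apply (Hg t1)]).
assert (HK : 0 <= delta / w)
  by (apply Rmult_le_pos; [auto | left; now apply Rinv_0_lt_compat]).
assert (HF : 0 < u1 t1 ^ 2) by (apply pow2_gt_0; auto).
assert (HE : osc_energy w u u1 t1 = u1 t1 ^ 2)
  by (unfold osc_energy; rewrite Hz; ring).
assert (A : forall S, 0 <= S <= 2 * (PI / w) ->
   Rabs (w * - (u1 t1 * u (t1 + S)) + u1 t1 ^ 2 * sin (w * S)) <= 4 * m * u1 t1 ^ 2).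
{ intros S HS.
  pose proof (wronskian_shift_approx w delta m S g u u1 t1 Hw Hu Hg) as H.
  rewrite HE, Hz in H.
  replace (- (u1 t1 * u (t1 + S))) with (0 * u1 (t1 + S) - u1 t1 * u (t1 + S)) by ring.
  apply H; try lra. nra. }
assert (A1 := A (PI / w - eta)). assert (A2 := A (PI / w + eta)).
replace (w * (PI / w - eta)) with (PI - w * eta) in A1 by (field; lra).
replace (w * (PI / w + eta)) with (w * eta + PI) in A2 by (field; lra).
rewrite sin_PI_x in A1. rewrite neg_sin in A2.
assert (B1 := proj1 (Rabs_le_between _ _) (A1 ltac:(lra))).
assert (B2 := proj1 (Rabs_le_between _ _) (A2 ltac:(lra))).
assert (C : 4 * m * u1 t1 ^ 2 < u1 t1 ^ 2 * sin (w * eta)).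
{ rewrite (Rmult_comm (u1 t1 ^ 2)). now apply Rmult_lt_compat_r. }
(* Multiplying by [u1 t1] fixes the signs: positive at the earlier endpoint, negative at the later
   one, hence the reversed order. *)
destruct (IVT_sign (fun s => u1 t1 * u s) (t1 + (PI / w + eta)) (t1 + (PI / w - eta)))
  as [z [Hzz Huz]].
- intros s. apply continuity_pt_scal, (hill_pair_continuity w g u u1 Hu).
- split; nra.
- rewrite Rmin_right, Rmax_left in Hzz by lra.
  exists (z - t1). split; [lra|].
  replace (t1 + (z - t1)) with z by ring.
  apply Rmult_integral in Huz; tauto.
Qed.

(** The Wronskian of [u] and its translate by [T] is constant for [t >= 0] and equals
    [- sin (w * T) / w] times the energy up to a small relative error, so the energies at [t] and at
    [0] are comparable. *)
Lemma hill_stable_of_periodic (w delta m c T : R) (g : R -> R) :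
  0 < w -> 0 <= T -> (forall x, Rabs (g x) <= delta) ->
  delta / w * T <= m -> m <= 1 -> 8 * m <= c -> 0 < c ->
  c <= Rabs (sin (w * T)) ->
  (forall t, 0 <= t -> g (t + T) = g t) ->
  forall u u1, hill_pair w g u u1 ->
  forall t, 0 <= t ->
    osc_energy w u u1 t <= 4 / c * osc_energy w u u1 0.
Proof.
intros Hw HT Hg Hm Hm1 Hc Hc0 Hsin Hper u u1 Hu t Ht.
set (Z := fun s => u s * u1 (s + T) - u1 s * u (s + T)).
assert (HZ : Z t = Z 0).
(* The derivative of [Z] is [(g s - g (s + T)) * u s * u (s + T)], zero on [[0, t]] by
   periodicity. *)
{ assert (K : Rabs (Z t - Z 0) <= 0 * (t - 0)).
  { apply (Rabs_increment_le Z
      (fun s => u s * (- (w ^ 2 + g (s + T)) * u (s + T))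
                - (- (w ^ 2 + g s) * u s) * u (s + T))); [lra| |].
    - intros s _. destruct (Hu s) as [H1 H2]. destruct (Hu (s + T)) as [H3 H4].
      apply is_derive_shift in H3. apply is_derive_shift in H4.
      set (v := fun s => u (s + T)). set (v1 := fun s => u1 (s + T)).
      change (is_derive v s (u1 (s + T))) in H3.
      change (is_derive v1 s (- (w ^ 2 + g (s + T)) * u (s + T))) in H4.
      apply (is_derive_ext (fun s => u s * v1 s - u1 s * v s)); [reflexivity|].
      auto_derive.
      + repeat split; [eexists; apply H1 | eexists; apply H4
                      |eexists; apply H2 | eexists; apply H3].
      + rewrite_derive H1. rewrite_derive H2. rewrite_derive H3. rewrite_derive H4.
        unfold v, v1. ring.
    - intros s Hs. rewrite Hper by lra. rewrite Rabs_right; lra. }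
  rewrite Rmult_0_l in K. pose proof (Rabs_pos (Z t - Z 0)).
  destruct (Req_dec (Z t - Z 0) 0) as [E|E]; [lra|].
  apply Rabs_pos_lt in E; lra. }
assert (Am : 0 <= m).
{ eapply Rle_trans; [|apply Hm]. apply Rmult_le_pos; [|auto].
  apply Rmult_le_pos; [|left; now apply Rinv_0_lt_compat].
  eapply Rle_trans; [apply Rabs_pos | apply (Hg t)]. }
pose proof (wronskian_shift_approx w delta m T g u u1 t Hw Hu Hg HT Hm Hm1) as At.
pose proof (wronskian_shift_approx w delta m T g u u1 0 Hw Hu Hg HT Hm Hm1) as A0.
fold (Z t) in At. fold (Z 0) in A0. rewrite HZ in At.
pose proof (osc_energy_nonneg w u u1 t) as Ft.
pose proof (osc_energy_nonneg w u u1 0) as F0.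
set (F := osc_energy w u u1 t) in *. set (G := osc_energy w u u1 0) in *.
set (s := sin (w * T)) in *.
assert (Hs1 : Rabs s <= 1) by (apply Rabs_le, SIN_bound).
assert (Lo : F * Rabs s - 4 * m * F <= Rabs (w * Z 0)).
{ pose proof (Rabs_triang (w * Z 0 + F * s) (- (w * Z 0))) as Tr.
  rewrite Rabs_Ropp in Tr.
  replace (w * Z 0 + F * s + - (w * Z 0)) with (F * s) in Tr by ring.
  rewrite Rabs_mult, (Rabs_pos_eq F) in Tr by auto. lra. }
assert (Up : Rabs (w * Z 0) <= G * Rabs s + 4 * m * G).
{ pose proof (Rabs_triang (w * Z 0 + G * s) (- (G * s))) as Tr.
  rewrite Rabs_Ropp in Tr.
  replace (w * Z 0 + G * s + - (G * s)) with (w * Z 0) in Tr by ring.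
  rewrite (Rabs_mult G), (Rabs_pos_eq G) in Tr by auto. lra. }
(* Since [4 * m <= c / 2] and [c <= Rabs s <= 1], the factor of [F] is at least [c / 2] and that of
   [G] at most [3 / 2]. *)
assert (Hcs : c / 2 * F <= 2 * G) by nra.
apply (Rmult_le_reg_l (c / 2)); [lra|].
replace (c / 2 * (4 / c * G)) with (2 * G) by (field; lra). exact Hcs.
Qed.

(** Zero data have zero energy, which the growth bound keeps at zero. *)
Lemma hill_pair_unique (w delta : R) (g u u1 : R -> R) (t1 t : R) :
  0 < w -> hill_pair w g u u1 -> (forall x, Rabs (g x) <= delta) ->
  u t1 = 0 -> u1 t1 = 0 -> t1 <= t -> u t = 0.
Proof.
intros Hw Hu Hg H0 H1 Ht.
pose proof (osc_energy_growth w delta g u u1 t1 (t - t1) Hw Hu Hg ltac:(lra)) as H.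
replace (t1 + (t - t1)) with t in H by ring.
unfold osc_energy in H. rewrite H0, H1 in H.
destruct (Req_dec (u t) 0) as [|E]; [auto|].
assert (0 < w ^ 2 * u t ^ 2) by (apply Rmult_lt_0_compat; now apply pow2_gt_0; lra).
pose proof (pow2_ge_0 (u1 t)). lra.
Qed.

(** * The Duffing equation *)

(** The nonlinear equation is read as a linear one whose perturbation [b * phi ^ 2] comes from the
    solution itself, so that the results on [hill_pair] apply. *)
Definition duffing_pair (w b : R) (phi phi1 : R -> R) : Prop :=
  hill_pair w (fun t => b * phi t ^ 2) phi phi1.

Definition duffing_energy (w b x y : R) : R :=
  y ^ 2 / 2 + w ^ 2 * (x ^ 2 / 2) + b * (x ^ 4 / 4).

Lemma duffing_energy_const (w b : R) (phi phi1 : R -> R) :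
  duffing_pair w b phi phi1 ->
  forall s t, duffing_energy w b (phi s) (phi1 s)
              = duffing_energy w b (phi t) (phi1 t).
Proof.
intros Hp.
apply (is_derive_zero_const (fun t => duffing_energy w b (phi t) (phi1 t))).
intros t. destruct (Hp t) as [H1 H2]. unfold duffing_energy.
auto_derive.
- repeat split; [eexists; apply H2 | eexists; apply H1 | eexists; apply H1].
- rewrite_derive H1. rewrite_derive H2. field.
Qed.

(* The largest value of [x ^ 2] on the level set [E] of the energy
   [y ^ 2 / 2 + P * (x ^ 2 / 2) + b * (x ^ 4 / 4)], written so that it stays
   meaningful at [b = 0]. *)
Definition amplitude_sq (P b E : R) : R := 4 * E / (P + sqrt (P ^ 2 + 4 * b * E)).

Lemma amplitude_sq_nonneg (P b E : R) :
  0 < P -> 0 <= E -> 0 <= amplitude_sq P b E.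
Proof.
intros HP HE. unfold amplitude_sq.
pose proof (sqrt_pos (P ^ 2 + 4 * b * E)).
apply Rmult_le_pos; [lra|]. left; apply Rinv_0_lt_compat; lra.
Qed.

(** The formula is the nonnegative root of [b X^2 / 4 + P X / 2 = E] with its numerator
    rationalised; clearing denominators and using [s ^ 2 = P ^ 2 + 4 * b * E] confirms it. *)
Lemma amplitude_sq_potential (P b E : R) :
  0 < P -> 0 <= b -> 0 <= E ->
  P * (amplitude_sq P b E / 2) + b * (amplitude_sq P b E ^ 2 / 4) = E.
Proof.
intros HP Hb HE. unfold amplitude_sq.
assert (Hr : 0 <= P ^ 2 + 4 * b * E) by nra.
pose proof (sqrt_pos (P ^ 2 + 4 * b * E)) as Hs.
pose proof (pow2_sqrt _ Hr) as Hs2.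
set (s := sqrt (P ^ 2 + 4 * b * E)) in *.
apply (Rmult_eq_reg_r ((P + s) ^ 2)); [|apply pow_nonzero; lra].
replace (_ * (P + s) ^ 2) with (E * (2 * P ^ 2 + 2 * P * s + 4 * b * E))
  by (field; lra).
replace (4 * b * E) with (s ^ 2 - P ^ 2) by lra. ring.
Qed.

Lemma potential_le_reg (P b x y : R) :
  0 < P -> 0 <= b -> 0 <= x -> 0 <= y ->
  P * (x / 2) + b * (x ^ 2 / 4) <= P * (y / 2) + b * (y ^ 2 / 4) -> x <= y.
Proof.
intros HP Hb Hx Hy H. apply Rnot_lt_le. intros Hlt.
assert (b * (y ^ 2) <= b * (x ^ 2)) by (apply Rmult_le_compat_l; nra). nra.
Qed.

Lemma amplitude_sq_increasing (P b x y : R) :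
  0 < P -> 0 <= b -> 0 <= x -> x < y -> amplitude_sq P b x < amplitude_sq P b y.
Proof.
intros HP Hb Hx Hxy.
pose proof (amplitude_sq_potential P b x HP Hb Hx) as Ex.
pose proof (amplitude_sq_potential P b y HP Hb ltac:(lra)) as Ey.
pose proof (amplitude_sq_nonneg P b x HP Hx) as Ax.
pose proof (amplitude_sq_nonneg P b y HP ltac:(lra)) as Ay.
apply Rnot_le_lt. intros Hle.
assert (b * amplitude_sq P b y ^ 2 <= b * amplitude_sq P b x ^ 2)
  by (apply Rmult_le_compat_l; nra).
nra.
Qed.

(** Obtained by dropping the quartic part of the potential; it turns a bound on the energy into one
    on the amplitude. *)
Lemma amplitude_sq_le_linear (P b E : R) :
  0 < P -> 0 <= b -> 0 <= E -> amplitude_sq P b E <= 2 * E / P.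
Proof.
intros HP Hb HE.
pose proof (amplitude_sq_potential P b E HP Hb HE) as Ex.
assert (0 <= b * amplitude_sq P b E ^ 2)
  by (apply Rmult_le_pos; [auto | apply pow2_ge_0]).
apply (Rmult_le_reg_l P); [auto|].
replace (P * (2 * E / P)) with (2 * E) by (field; lra). lra.
Qed.

(** The potential energy never exceeds the conserved total energy, and it is increasing in
    [phi ^ 2]. *)
Lemma duffing_sq_le (w b E : R) (phi phi1 : R -> R) (t : R) :
  0 < w -> 0 <= b -> duffing_pair w b phi phi1 ->
  duffing_energy w b (phi 0) (phi1 0) = E ->
  phi t ^ 2 <= amplitude_sq (w ^ 2) b E.
Proof.
intros Hw Hb Hp HE.
rewrite (duffing_energy_const w b phi phi1 Hp 0 t) in HE.
unfold duffing_energy in HE.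
pose proof (pow2_ge_0 (phi1 t)). pose proof (pow2_ge_0 (phi t)).
assert (HP : 0 < w ^ 2) by (apply pow2_gt_0; lra).
assert (H4 : 0 <= phi t ^ 4) by
    (replace (phi t ^ 4) with ((phi t ^ 2) ^ 2) by ring; apply pow2_ge_0).
assert (HE0 : 0 <= E) by nra.
apply (potential_le_reg (w ^ 2) b); auto.
- now apply amplitude_sq_nonneg.
- rewrite amplitude_sq_potential by auto.
  replace ((phi t ^ 2) ^ 2) with (phi t ^ 4) by ring. lra.
Qed.

Lemma duffing_zero (w b : R) (phi phi1 : R -> R) (t0 : R) :
  0 < w -> 0 <= b -> duffing_pair w b phi phi1 ->
  exists x, t0 <= x <= t0 + PI / w /\ phi x = 0.
Proof.
intros Hw Hb Hp.
apply (hill_pair_zero w (fun t => b * phi t ^ 2) phi phi1); auto.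
intros x. apply Rmult_le_pos; [auto | apply pow2_ge_0].
Qed.

(** Between two zeros of [phi] its derivative vanishes somewhere; there the energy is all
    potential. *)
Lemma duffing_sq_max (w b E : R) (phi phi1 : R -> R) :
  0 < w -> 0 <= b -> duffing_pair w b phi phi1 ->
  duffing_energy w b (phi 0) (phi1 0) = E ->
  exists t, phi t ^ 2 = amplitude_sq (w ^ 2) b E.
Proof.
intros Hw Hb Hp HE.
destruct (duffing_zero w b phi phi1 0 Hw Hb Hp) as [x [Hx Hx0]].
(* Starting at [x + 1] makes the second zero distinct from the first. *)
destruct (duffing_zero w b phi phi1 (x + 1) Hw Hb Hp) as [y [Hy Hy0]].
destruct (MVT_gen phi x y phi1) as [c [_ Hc]].
- intros t _. apply (Hp t).
- intros t _. apply (hill_pair_continuity _ _ _ _ Hp).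
- rewrite Hx0, Hy0 in Hc.
  assert (Hc0 : phi1 c = 0).
  { assert (Hm : phi1 c * (y - x) = 0) by lra.
    apply Rmult_integral in Hm. destruct Hm; lra. }
  exists c.
  rewrite (duffing_energy_const w b phi phi1 Hp 0 c) in HE.
  unfold duffing_energy in HE. rewrite Hc0 in HE.
  pose proof (pow2_ge_0 (phi c)).
  assert (HP : 0 < w ^ 2) by (apply pow2_gt_0; lra).
  assert (H4 : 0 <= phi c ^ 4) by
    (replace (phi c ^ 4) with ((phi c ^ 2) ^ 2) by ring; apply pow2_ge_0).
  assert (HE0 : 0 <= E) by nra.
  pose proof (amplitude_sq_nonneg (w ^ 2) b E HP HE0) as HA.
  assert (HV : w ^ 2 * (phi c ^ 2 / 2) + b * ((phi c ^ 2) ^ 2 / 4) = E)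
    by (rewrite <- HE; field).
  pose proof (amplitude_sq_potential (w ^ 2) b E HP Hb HE0) as HV'.
  apply Rle_antisym; apply (potential_le_reg (w ^ 2) b); auto; lra.
Qed.

(* At two zeros of [phi] the derivatives agree up to sign by conservation of
   energy, so the translate of [phi] by the gap is [phi] or [- phi]. *)
Lemma duffing_sq_periodic (w b : R) (phi phi1 : R -> R) (t1 T : R) :
  0 < w -> 0 <= b -> duffing_pair w b phi phi1 ->
  phi t1 = 0 -> phi (t1 + T) = 0 ->
  forall t, t1 <= t -> phi (t + T) ^ 2 = phi t ^ 2.
Proof.
intros Hw Hb Hp H0 HT.
set (E := duffing_energy w b (phi 0) (phi1 0)).
set (A := amplitude_sq (w ^ 2) b E).
assert (HA : forall t, phi t ^ 2 <= A) by (intros t; now apply (duffing_sq_le w b E phi phi1)).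
assert (Hsgn : exists e, e ^ 2 = 1 /\ phi1 (t1 + T) = e * phi1 t1).
{ pose proof (duffing_energy_const w b phi phi1 Hp t1 (t1 + T)) as He.
  unfold duffing_energy in He. rewrite H0, HT in He.
  assert (Hm : (phi1 (t1 + T) - phi1 t1) * (phi1 (t1 + T) + phi1 t1) = 0) by lra.
  apply Rmult_integral in Hm. destruct Hm; [exists 1 | exists (-1)]; split; lra. }
destruct Hsgn as [e [He Hd]].
(* Since [e ^ 2 = 1], the difference of the cubic terms factors as [g] times
   [phi (t + T) - e * phi t]; this last function thus solves a linear equation with bounded [g] and
   zero data at [t1]. *)
set (g := fun t => b * (phi (t + T) ^ 2 + e * phi (t + T) * phi t + phi t ^ 2)).
assert (Hz : hill_pair w g (fun t => phi (t + T) - e * phi t)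
                           (fun t => phi1 (t + T) - e * phi1 t)).
{ intros t. destruct (Hp t) as [H1 H2]. destruct (Hp (t + T)) as [H3 H4].
  apply is_derive_shift in H3. apply is_derive_shift in H4. split.
  - apply (is_derive_minus (fun t => phi (t + T)) (fun t => e * phi t)); [exact H3|].
    now apply is_derive_scal.
  - replace (- (w ^ 2 + g t) * (phi (t + T) - e * phi t)) with
      (minus (- (w ^ 2 + b * phi (t + T) ^ 2) * phi (t + T))
             (e * (- (w ^ 2 + b * phi t ^ 2) * phi t))).
    + apply (is_derive_minus (fun t => phi1 (t + T)) (fun t => e * phi1 t)); [exact H4|].
      now apply is_derive_scal.
    + unfold minus, plus, opp, g; simpl.
      transitivity (- w ^ 2 * (phi (t + T) - e * phi t)
        - b * (phi (t + T) ^ 3 - e * phi t ^ 3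
               + (1 - e ^ 2) * phi t ^ 2 * phi (t + T))).
      * rewrite He. ring.
      * ring. }
intros t Ht.
assert (Hzt : phi (t + T) - e * phi t = 0).
{ apply (hill_pair_unique w (b * (3 * A)) g _ _ t1 t Hw Hz); auto.
  - intros x. unfold g. rewrite Rabs_mult, (Rabs_pos_eq b) by auto.
    apply Rmult_le_compat_l; [auto|].
    pose proof (HA x). pose proof (HA (x + T)).
    assert (0 <= (phi (x + T) + e * phi x) ^ 2) by apply pow2_ge_0.
    assert (0 <= (phi (x + T) - e * phi x) ^ 2) by apply pow2_ge_0.
    assert (e ^ 2 * phi x ^ 2 = phi x ^ 2) by (rewrite He; ring).
    apply Rabs_le. nra.
  - rewrite H0, HT. ring.
  - rewrite Hd. ring. }
replace (phi (t + T)) with (e * phi t) by lra.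
rewrite Rpow_mult_distr, He. ring.
Qed.

(** * Stability at small amplitude *)

(** The sine is 1-Lipschitz, so [Rabs (sin x) / 2] serves as [eta]. *)
Lemma sin_bounded_away (x : R) :
  sin x <> 0 ->
  exists eta, 0 < eta /\ forall y, Rabs (y - x) <= eta -> Rabs (sin x) / 2 <= Rabs (sin y).
Proof.
intros Hx.
exists (Rabs (sin x) / 2). split; [apply Rabs_pos_lt in Hx; lra|].
intros y Hy.
assert (H : Rabs (sin x - sin y) <= Rabs (y - x)).
{ destruct (MVT_gen sin x y cos) as [c [_ Hc]].
  - intros t _. apply is_derive_Reals, derivable_pt_lim_sin.
  - intros t _. apply continuity_sin.
  - rewrite Rabs_minus_sym, Hc, Rabs_mult.
    assert (Rabs (cos c) <= 1) by (apply Rabs_le, COS_bound).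
    pose proof (Rabs_pos (y - x)). nra. }
pose proof (Rabs_triang_inv (sin x) (sin y)). lra.
Qed.

(** [A] and [K] are fixed before [phi] is given. A small amplitude places two zeros of [phi] at a
    distance [T] near [PI / w], and non-resonance keeps [sin (w' * T)] away from zero. *)
Lemma hill_stable_small_amplitude (w w' b d : R) :
  0 < w -> 0 < w' -> 0 <= b -> (forall n : nat, w' / w <> INR n) ->
  exists A K, 0 < A /\ 0 < K /\
    forall phi phi1, duffing_pair w b phi phi1 ->
      0 < duffing_energy w b (phi 0) (phi1 0) ->
      amplitude_sq (w ^ 2) b (duffing_energy w b (phi 0) (phi1 0)) <= A ->
      forall u u1, hill_pair w' (fun t => d * phi t ^ 2) u u1 ->
      forall t, 0 <= t ->
        osc_energy w' u u1 t <= K * osc_energy w' u u1 0.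
Proof.
intros Hw Hw' Hb Hres.
pose proof PI_RGT_0 as Hpi.
assert (Hlen : 0 < PI / w) by now apply Rdiv_lt_0_compat.
set (x0 := w' * (PI / w)).
assert (Hx0 : sin x0 <> 0).
(* [sin x0 = 0] makes [w' / w] an integer, and a positive one, hence a natural number. *)
{ intros H. apply sin_eq_0_0 in H. destruct H as [k Hk].
  assert (Hq : w' / w = IZR k).
  { apply (Rmult_eq_reg_r PI); [|lra]. rewrite <- Hk. unfold x0. field. lra. }
  assert (Hk0 : (0 <= k)%Z).
  { apply le_IZR. rewrite <- Hq. left. now apply Rdiv_lt_0_compat. }
  apply (Hres (Z.to_nat k)). rewrite Hq, INR_IZR_INZ, Z2Nat.id; auto. }
destruct (sin_bounded_away x0 Hx0) as [eta1 [Heta1 Hfar]].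
set (c := Rabs (sin x0) / 2) in *.
assert (Hc : 0 < c) by (unfold c; apply Rabs_pos_lt in Hx0; lra).
(* The first bound keeps [w' * T] within [eta1] of [x0]; the second serves to locate the next
   zero. *)
set (eta := Rmin (eta1 / w') (PI / (2 * w))).
assert (Heta : 0 < eta).
{ apply Rmin_glb_lt; apply Rdiv_lt_0_compat; lra. }
assert (He1 : w' * eta <= eta1).
{ apply Rle_trans with (w' * (eta1 / w')); [|right; field; lra].
  apply Rmult_le_compat_l; [lra | apply Rmin_l]. }
assert (He2 : eta <= PI / (2 * w)) by apply Rmin_r.
assert (He3 : w * eta <= PI / 2).
{ apply Rle_trans with (w * (PI / (2 * w))); [|right; field; lra].
  apply Rmult_le_compat_l; lra. }
assert (He4 : eta <= PI / w / 2) by (apply (Rle_trans _ _ _ He2); right; field; lra).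
assert (Hse : 0 < sin (w * eta)) by (apply sin_gt_0; nra).
(* The three bounds serve the growth estimate, the stability estimate and the sign change at the
   next zero. *)
set (m := Rmin 1 (Rmin (c / 8) (sin (w * eta) / 8))).
assert (Hm0 : 0 < m) by (repeat apply Rmin_glb_lt; lra).
assert (Hm1 : m <= 1) by apply Rmin_l.
assert (Hm2 : 8 * m <= c).
{ assert (m <= c / 8) by (eapply Rle_trans; [apply Rmin_r | apply Rmin_l]). lra. }
assert (Hm3 : 4 * m < sin (w * eta)).
{ assert (m <= sin (w * eta) / 8) by (eapply Rle_trans; [apply Rmin_r | apply Rmin_r]). lra. }
(* [L] exceeds every admissible gap [T <= PI / w + eta]. *)
set (L := 2 * (PI / w)).
set (q1 := b / w * L). set (q2 := Rabs d / w' * L).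
assert (HL : 0 < L) by (unfold L; lra).
assert (Hq1 : 0 <= q1).
{ unfold q1. apply Rmult_le_pos; [|lra].
  apply Rmult_le_pos; [auto | left; now apply Rinv_0_lt_compat]. }
assert (Hq2 : 0 <= q2).
{ unfold q2. apply Rmult_le_pos; [|lra].
  apply Rmult_le_pos; [apply Rabs_pos | left; now apply Rinv_0_lt_compat]. }
(* Gives [A * q1 <= m] and [A * q2 <= m], the smallness of the two perturbations; the [1] keeps the
   denominator positive when [b = d = 0]. *)
set (A := m / (1 + q1 + q2)).
assert (HA : 0 < A) by (apply Rdiv_lt_0_compat; lra).
assert (HAm : A * (1 + q1 + q2) = m) by (unfold A; field; lra).
exists A, (4 / c). split; [auto|]. split; [apply Rdiv_lt_0_compat; lra|].
intros phi phi1 Hp HE Hsmall u u1 Hu t Ht.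
assert (Hphi : forall s, phi s ^ 2 <= A).
{ intros s. eapply Rle_trans; [|apply Hsmall].
  now apply (duffing_sq_le w b _ phi phi1). }
(* A zero at a time [t1 <= 0] makes the periodicity of [phi ^ 2] available at every [t >= 0]. *)
destruct (duffing_zero w b phi phi1 (- (PI / w)) Hw Hb Hp) as [t1 [Ht1 Hz1]].
(* Positive energy excludes a double zero. *)
assert (Hnz : phi1 t1 <> 0).
{ intros Hz. rewrite (duffing_energy_const w b phi phi1 Hp 0 t1) in HE.
  unfold duffing_energy in HE. rewrite Hz1, Hz in HE. lra. }
assert (Hbd : forall (e s : R), Rabs (e * phi s ^ 2) <= Rabs e * A).
{ intros e s. rewrite Rabs_mult, (Rabs_pos_eq (phi s ^ 2)) by apply pow2_ge_0.
  apply Rmult_le_compat_l; [apply Rabs_pos | apply Hphi]. }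
destruct (hill_pair_next_zero w (b * A) m eta (fun s => b * phi s ^ 2) phi phi1 t1)
  as [T [HT HzT]]; auto.
{ intros s. eapply Rle_trans; [apply Hbd|]. rewrite Rabs_pos_eq; lra. }
{ fold L. replace (b * A / w * L) with (A * q1) by (unfold q1; field; lra). nra. }
apply (hill_stable_of_periodic w' (Rabs d * A) m c T (fun s => d * phi s ^ 2)); auto.
- lra.
- apply Rle_trans with (Rabs d * A / w' * L).
  + apply Rmult_le_compat_l; [|unfold L; lra].
    apply Rmult_le_pos; [|left; now apply Rinv_0_lt_compat].
    apply Rmult_le_pos; [apply Rabs_pos | lra].
  + replace (Rabs d * A / w' * L) with (A * q2) by (unfold q2; field; lra). nra.
- apply Hfar. unfold x0. replace (w' * T - w' * (PI / w)) with (w' * (T - PI / w)) by ring.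
  rewrite Rabs_mult, (Rabs_pos_eq w') by lra.
  eapply Rle_trans; [|apply He1]. apply Rmult_le_compat_l; [lra|].
  apply Rabs_le; lra.
- intros s Hs. f_equal.
  apply (duffing_sq_periodic w b phi phi1 t1 T); auto; lra.
Qed.

Lemma lyapunov_stable_of_energy_bound (w K : R) (g : R -> R) :
  0 < w -> 0 < K ->
  (forall u u1, hill_pair w g u u1 ->
     forall t, 0 <= t -> osc_energy w u u1 t <= K * osc_energy w u u1 0) ->
  lyapunov_stable (fun t => w ^ 2 + g t).
Proof.
intros Hw HK H eps Heps.
(* The initial energy is at most [(w ^ 2 + 1) * delta ^ 2], so the later one is at most
   [X * delta ^ 2 < (eps * r) ^ 2]. Then [r <= w] handles [xi] and [r <= 1] its derivative. *)
set (X := K * (w ^ 2 + 1)).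
assert (HX : 0 < X) by (unfold X; nra).
set (r := Rmin 1 w).
assert (Hr : 0 < r) by (apply Rmin_glb_lt; lra).
assert (Hr1 : r <= 1) by apply Rmin_l.
assert (Hrw : r <= w) by apply Rmin_r.
set (delta := eps * r / (1 + X)).
assert (Hd : 0 < delta).
{ apply Rdiv_lt_0_compat; [|lra]. now apply Rmult_lt_0_compat. }
assert (HdX : delta * (1 + X) = eps * r) by (unfold delta; field; lra).
exists delta. split; [auto|].
intros xi [Hxi Hode] H0 H1 t Ht.
assert (Hp : hill_pair w g xi (Derive xi)).
{ intros s. destruct (Hxi s) as [D1 D2]. split; [now apply Derive_correct|].
  replace (- (w ^ 2 + g s) * xi s) with (Derive (Derive xi) s)
    by (specialize (Hode s); lra).
  now apply Derive_correct. }
assert (HF := H _ _ Hp t Ht). unfold osc_energy in HF.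
assert (S0 : xi 0 ^ 2 <= delta ^ 2).
{ rewrite <- pow2_abs. pose proof (Rabs_pos (xi 0)). nra. }
assert (S1 : Derive xi 0 ^ 2 <= delta ^ 2).
{ rewrite <- pow2_abs. pose proof (Rabs_pos (Derive xi 0)). nra. }
assert (HB : w ^ 2 * xi t ^ 2 + Derive xi t ^ 2 < (eps * r) ^ 2).
{ assert (w ^ 2 * xi 0 ^ 2 <= w ^ 2 * delta ^ 2)
    by (apply Rmult_le_compat_l; [apply pow2_ge_0 | auto]).
  assert (K * (w ^ 2 * xi 0 ^ 2 + Derive xi 0 ^ 2) <= X * delta ^ 2).
  { replace (X * delta ^ 2) with (K * (w ^ 2 * delta ^ 2 + delta ^ 2))
      by (unfold X; ring).
    apply Rmult_le_compat_l; lra. }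
  assert (0 < delta ^ 2) by (apply pow2_gt_0; lra).
  rewrite <- HdX. nra. }
assert (Her : 0 < eps * r) by now apply Rmult_lt_0_compat.
split.
- assert (Hl : (w * xi t) ^ 2 < (eps * r) ^ 2) by (pose proof (pow2_ge_0 (Derive xi t)); lra).
  assert (Ha : Rabs (w * xi t) < eps * r).
  { rewrite <- (Rabs_pos_eq (eps * r)) by lra. apply Rsqr_lt_abs_0. unfold Rsqr. lra. }
  rewrite Rabs_mult, (Rabs_pos_eq w) in Ha by lra.
  pose proof (Rabs_pos (xi t)). nra.
- assert (Hl : (Derive xi t) ^ 2 < (eps * r) ^ 2)
    by (assert (0 <= w ^ 2 * xi t ^ 2) by (apply Rmult_le_pos; apply pow2_ge_0); lra).
  assert (Ha : Rabs (Derive xi t) < eps * r).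
  { rewrite <- (Rabs_pos_eq (eps * r)) by lra. apply Rsqr_lt_abs_0. unfold Rsqr. lra. }
  nra.
Qed.

(** Attainment makes the supremum the finite number [sqrt A], so the extended product is the real
    one. *)
Lemma sup_norm_of_max_sq (f : R -> R) (A : R) :
  (forall t, f t ^ 2 <= A) -> (exists t, f t ^ 2 = A) ->
  Rbar_mult (sup_norm f) (sup_norm f) = Finite A.
Proof.
intros Hle [t0 Ht0].
assert (HA : 0 <= A) by (rewrite <- Ht0; apply pow2_ge_0).
assert (Hs : forall x, sqrt (x ^ 2) = Rabs x).
{ intros x. rewrite <- (sqrt_Rsqr_abs x). f_equal. unfold Rsqr; ring. }
assert (Hn : sup_norm f = Finite (sqrt A)).
{ apply is_lub_Rbar_unique. split.
  - intros y [t ->]. simpl. rewrite <- Hs. now apply sqrt_le_1_alt.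
  - intros B HB. apply HB. exists t0. now rewrite <- Ht0, Hs. }
rewrite Hn. simpl. now rewrite sqrt_sqrt.
Qed.

(** * Signs of the coefficients *)

(* Holds at [y = 0] because [/ 0 = 0]. *)
Lemma Rdiv_nonneg (x y : R) : 0 <= x -> 0 <= y -> 0 <= x / y.
Proof.
intros Hx [Hy | <-].
- apply Rmult_le_pos; [auto | left; now apply Rinv_0_lt_compat].
- unfold Rdiv. rewrite Rinv_0. lra.
Qed.

Lemma RInt_continuous_nonneg (f : R -> R) (x y : R) :
  x <= y -> (forall t, ex_derive f t) -> (forall t, 0 <= f t) -> 0 <= RInt f x y.
Proof.
intros Hxy Hf Hpos. apply RInt_ge_0; auto.
apply (ex_RInt_continuous f). intros t _. now apply (ex_derive_continuous f).
Qed.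

Lemma ex_derive_v (mu : nat -> R) (k : nat) (y : R) : ex_derive (v mu k) y.
Proof. unfold v, cosh. auto_derive. trivial. Qed.

Lemma ex_derive_theta (nu : nat -> R) (k : nat) (y : R) : ex_derive (theta nu k) y.
Proof. unfold theta, sinh. auto_derive. trivial. Qed.

Lemma omega_sq_nonneg (mu : nat -> R) (k : nat) : 0 <= omega_sq mu k.
Proof.
pose proof PI_RGT_0. unfold omega_sq. apply Rmult_le_pos; [lra|].
apply RInt_continuous_nonneg; [lra | | intros; apply pow2_ge_0].
intros t. apply (ex_derive_pow (v mu k) 2), ex_derive_v.
Qed.

Lemma omegabar_sq_nonneg (nu : nat -> R) (l : nat) : 0 <= omegabar_sq nu l.
Proof.
pose proof PI_RGT_0. unfold omegabar_sq. apply Rmult_le_pos; [lra|].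
apply RInt_continuous_nonneg; [lra | | intros; apply pow2_ge_0].
intros t. apply (ex_derive_pow (theta nu l) 2), ex_derive_theta.
Qed.

Lemma a_nonneg (mu : nat -> R) (k : nat) : 0 <= a mu k.
Proof.
pose proof PI_RGT_0. unfold a. apply Rmult_le_pos.
- apply Rdiv_nonneg; [lra | apply omega_sq_nonneg].
- apply RInt_continuous_nonneg; [lra | | intros; apply pow2_ge_0].
  intros t. apply (ex_derive_pow (v mu k) 2), ex_derive_v.
Qed.

Lemma abar_nonneg (nu : nat -> R) (l : nat) : 0 <= abar nu l.
Proof.
pose proof PI_RGT_0. unfold abar. apply Rmult_le_pos.
- apply Rdiv_nonneg; [lra | apply omegabar_sq_nonneg].
- apply RInt_continuous_nonneg; [lra | | intros; apply pow2_ge_0].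
  intros t. apply (ex_derive_pow (theta nu l) 2), ex_derive_theta.
Qed.

Lemma b_nonneg (mu : nat -> R) (k : nat) : 0 <= b mu k.
Proof.
pose proof PI_RGT_0. unfold b. apply Rmult_le_pos.
- apply Rdiv_nonneg; [lra|]. pose proof (pow2_ge_0 (omega_sq mu k)). lra.
- apply RInt_continuous_nonneg; [lra | |].
  + intros t. apply (ex_derive_pow (v mu k) 4), ex_derive_v.
  + intros t. replace (v mu k t ^ 4) with ((v mu k t ^ 2) ^ 2) by ring.
    apply pow2_ge_0.
Qed.

(** * Stability of the longitudinal modes *)

Lemma mode_duffing_pair (gamma w : R) (mu : nat -> R) (k : nat) (phi0 phi1 : R)
    (phi : R -> R) :
  w ^ 2 = gamma * mu k + a mu k ->
  is_longitudinal_mode gamma mu k phi0 phi1 phi ->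
  duffing_pair w (b mu k) phi (Derive phi) /\
  duffing_energy w (b mu k) (phi 0) (Derive phi 0) = energy gamma mu k phi0 phi1.
Proof.
intros Hw [Hd [Hode [H0 H1]]]. split.
- intros t. destruct (Hd t) as [D1 D2]. split; [now apply Derive_correct|].
  replace (- (w ^ 2 + b mu k * phi t ^ 2) * phi t) with (Derive (Derive phi) t)
    by (specialize (Hode t); rewrite Hw; lra).
  now apply Derive_correct.
- unfold duffing_energy, energy. now rewrite H0, H1, Hw.
Qed.

Theorem theorem4p4 (gamma : R) (hgamma : 0 < gamma) (mu nu : nat -> R)
    (hmu : forall j : nat, (1 <= j <= 14)%nat -> is_mu1 j (mu j))
    (hnu : forall j : nat, (1 <= j <= 2)%nat -> is_nu2 j (nu j))
    (k l : nat) (hk : (1 <= k <= 14)%nat) (hl : (1 <= l <= 2)%nat)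
    (hres : forall n : nat,
       sqrt ((gamma * nu l + abar nu l) / (gamma * mu k + a mu k)) <> INR n) :
  exists (E_kl : R) (Lambda : R -> R),
    0 < E_kl /\
    (forall x : R, 0 <= x -> 0 <= Lambda x) /\
    (forall x y : R, 0 <= x -> x < y -> Lambda x < Lambda y) /\
    Lambda 0 = 0 /\
    forall (phi0 phi1 : R) (phi : R -> R),
      (phi0, phi1) <> (0, 0) ->
      is_longitudinal_mode gamma mu k phi0 phi1 phi ->
      0 < energy gamma mu k phi0 phi1 ->
      (energy gamma mu k phi0 phi1 <= E_kl ->
         torsionally_stable gamma mu nu l k phi) /\
      (Rbar_le (Rbar_mult (sup_norm phi) (sup_norm phi)) (Finite (Lambda E_kl)) ->
         torsionally_stable gamma mu nu l k phi) /\
      (energy gamma mu k phi0 phi1 <= E_kl <->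
         Rbar_le (Rbar_mult (sup_norm phi) (sup_norm phi)) (Finite (Lambda E_kl))).
Proof.
assert (Hk : 0 < INR k) by (apply lt_0_INR; lia).
assert (Hl : 0 < INR l) by (apply lt_0_INR; lia).
assert (Hmuk : 0 < mu k).
{ destruct (hmu k hk) as [[H _] _]. unfold Defs.sigma in H.
  assert (0 < INR k ^ 4) by now apply pow_lt. nra. }
assert (Hnul : 0 < nu l).
{ destruct (hnu l hl) as [H _].
  assert (0 < INR l ^ 4) by now apply pow_lt. lra. }
pose proof (a_nonneg mu k) as Ha. pose proof (abar_nonneg nu l) as Hab.
pose proof (b_nonneg mu k) as Hb.
(* The integral terms are nonnegative; strict positivity comes from [gamma * mu k] and
   [gamma * nu l]. *)
assert (HP : 0 < gamma * mu k + a mu k) by nra.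
assert (HQ : 0 < gamma * nu l + abar nu l) by nra.
set (P := gamma * mu k + a mu k) in *. set (Q := gamma * nu l + abar nu l) in *.
set (w := sqrt P). set (w' := sqrt Q).
assert (Hw : 0 < w) by now apply sqrt_lt_R0.
assert (Hw' : 0 < w') by now apply sqrt_lt_R0.
assert (Hw2 : w ^ 2 = P) by (apply pow2_sqrt; lra).
assert (Hw2' : w' ^ 2 = Q) by (apply pow2_sqrt; lra).
destruct (hill_stable_small_amplitude w w' (b mu k) (d mu nu l k)) as
  [A [K [HA [HK Hstab]]]]; auto.
(* The quotient of the roots is the root of the quotient, so non-resonance reads
   [w' / w <> INR n]. *)
{ intros n. unfold w, w'. rewrite <- sqrt_div_alt by auto. apply hres. }
(* Chosen so that the linear bound [2 * E0 / P] on the squared amplitude equals [A]. *)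
set (E0 := P * A / 2).
assert (HE0 : 0 < E0) by (unfold E0; nra).
assert (HLE0 : amplitude_sq P (b mu k) E0 <= A).
{ eapply Rle_trans; [apply amplitude_sq_le_linear; lra|].
  right. unfold E0. field. lra. }
(* [Lambda] is the exact relation between energy and squared sup-norm; being strictly increasing, it
   makes the two conditions equivalent. *)
exists E0, (amplitude_sq P (b mu k)).
split; [auto|].
split; [intros; now apply amplitude_sq_nonneg|].
split; [intros; now apply amplitude_sq_increasing|].
split; [unfold amplitude_sq; lra|].
intros phi0 phi1 phi _ Hmode HE.
destruct (mode_duffing_pair gamma w mu k phi0 phi1 phi Hw2 Hmode) as [Hp Hen].
set (E := energy gamma mu k phi0 phi1) in *.
assert (Hsup : Rbar_mult (sup_norm phi) (sup_norm phi)
               = Finite (amplitude_sq P (b mu k) E)).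
{ rewrite <- Hw2. apply sup_norm_of_max_sq.
  - intros t. now apply (duffing_sq_le w (b mu k) E phi (Derive phi)).
  - now apply (duffing_sq_max w (b mu k) E phi (Derive phi)). }
assert (Hequiv : E <= E0 <-> amplitude_sq P (b mu k) E <= amplitude_sq P (b mu k) E0).
{ split; intros H.
  - destruct H as [H | ->]; [|apply Rle_refl].
    left. apply amplitude_sq_increasing; lra.
  - apply Rnot_lt_le. intros Hlt.
    apply (amplitude_sq_increasing P (b mu k)) in Hlt; lra. }
assert (Hst : E <= E0 -> torsionally_stable gamma mu nu l k phi).
{ intros H. unfold torsionally_stable, hill_coefficient. fold Q. rewrite <- Hw2'.
  apply (lyapunov_stable_of_energy_bound w' K); auto.
  apply (Hstab phi (Derive phi) Hp); rewrite Hen; auto.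
  rewrite Hw2. apply Hequiv in H. lra. }
rewrite Hsup. simpl. repeat split; auto; try tauto.
Qed.
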